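(* Let $T\ge 2$ be an integer and let $\mu>0$, $\sigma>0$, $-\frac{1}{T-1}<\rho<1$ satisfy $\mu^2+\rho\sigma^2>0$. Let $$\mathrm{L}(\gamma)=\sup_{\mathbb P\in\mathcal P}\mathbb P\Big(\prod_{t=1}^T\tilde\xi_t\le\gamma\Big),\qquad \mathrm{L}'(\gamma)=\sup_{\mathbb P\in\mathcal P'}\mathbb P\Big(\prod_{t=1}^T\tilde\xi_t\le\gamma\Big),$$ with the ambiguity sets $\mathcal P$ and $\mathcal P'$ defined in the context. Then $\mathrm{L}'(\gamma)=\mathrm{L}(\gamma)$ for all $\gamma>0$.
   Context: Let $\boldsymbol\mu=\mu\boldsymbol 1\in\mathbb R^T$ and $\boldsymbol\Sigma=(1-\rho)\sigma^2\mathbb I+\rho\sigma^2\boldsymbol 1\boldsymbol 1^\intercal$, where $\mathbb I$ is the $T\times T$ identity matrix and $\boldsymbol 1$ the all-ones vector. $\mathcal P$ is the set of all Borel probability distributions $\mathbb P$ of a random vector $\tilde{\boldsymbol\xi}=(\tilde\xi_1,\dots,\tilde\xi_T)^\intercal$ supported on $\mathbb R^T_+$ with $\mathbb E_{\mathbb P}(\tilde{\boldsymbol\xi})=\boldsymbol\mu$ and $\mathbb E_{\mathbb P}(\tilde{\boldsymbol\xi}\tilde{\boldsymbol\xi}^\intercal)=\boldsymbol\Sigma+\boldsymbol\mu\boldsymbol\mu^\intercal$. $\mathcal P'$ is defined in the same way, except that the last condition is relaxed to $\mathbb E_{\mathbb P}(\tilde{\boldsymbol\xi}\tilde{\boldsymbol\xi}^\intercal)\preceq\boldsymbol\Sigma+\boldsymbol\mu\boldsymbol\mu^\intercal$,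 where $\boldsymbol A\preceq\boldsymbol B$ means that $\boldsymbol B-\boldsymbol A$ is positive semidefinite. *)

(* Defs.v *)
From mathcomp Require Import all_boot all_order all_algebra.
From mathcomp Require Import all_classical all_reals all_analysis.
Set Implicit Arguments.
Unset Strict Implicit.
Unset Printing Implicit Defensive.
Import Order.TTheory GRing.Theory Num.Theory.
Import numFieldNormedType.Exports.
Local Open Scope classical_set_scope.
Local Open Scope ring_scope.

(* R^T, as column vectors, with its Borel sigma-algebra.  A random vector is
   identified with its law, so the sample space is R^T itself and xi is the
   identity. *)
Definition borel_cV (R : realType) (T : nat) := g_sigma_algebraType (@open 'cV[R]_T).

Definition mx_integrable d (W : measurableType d) (R : realType)
    (P : probability W R) m n (X : W -> 'M[R]_(m, n)) : Prop :=
  forall i j, P.-integrable [set: W] (fun w => (X w i j)%:E).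

(* Meaningful only when [mx_integrable P X] holds, because of [fine]. *)
Definition mx_expectation d (W : measurableType d) (R : realType)
    (P : probability W R) m n (X : W -> 'M[R]_(m, n)) : 'M[R]_(m, n) :=
  \matrix_(i, j) fine 'E_P[fun w => X w i j].

Definition psdmx (R : realType) n (A : 'M[R]_n) : Prop :=
  A^T = A /\ forall v : 'cV[R]_n, 0 <= (v^T *m A *m v) 0 0.

Definition loewner_le (R : realType) n (A B : 'M[R]_n) : Prop := psdmx (B - A).

Section Ambiguity.
Variables (R : realType) (T : nat).
Implicit Types (P : probability (borel_cV R T) R) (m : 'cV[R]_T) (S : 'M[R]_T).

Definition rvec (x : borel_cV R T) : 'cV[R]_T := x.

Definition outer (x : borel_cV R T) : 'M[R]_T := rvec x *m (rvec x)^T.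

Definition mean_vec (mu : R) : 'cV[R]_T := const_mx mu.

Definition cov_mx (sigma rho : R) : 'M[R]_T :=
  ((1 - rho) * sigma ^+ 2) *: 1%:M
  + (rho * sigma ^+ 2) *: ((const_mx 1 : 'cV[R]_T) *m (const_mx 1 : 'cV[R]_T)^T).

Definition nonneg_supported P : Prop :=
  P [set x | forall t, 0 <= rvec x t 0] = 1%E.

Definition ambiguity m S : set (probability (borel_cV R T) R) :=
  [set P | [/\ nonneg_supported P,
               mx_integrable P rvec /\ mx_expectation P rvec = m &
               mx_integrable P outer /\
               mx_expectation P outer = S + m *m m^T]].

Definition ambiguity_relaxed m S : set (probability (borel_cV R T) R) :=
  [set P | [/\ nonneg_supported P,
               mx_integrable P rvec /\ mx_expectation P rvec = m &
               mx_integrable P outer /\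
               loewner_le (mx_expectation P outer) (S + m *m m^T)]].

Definition worst_case_prob (A : set (probability (borel_cV R T) R)) (gamma : R)
    : \bar R :=
  ereal_sup [set P [set x | \prod_(t < T) rvec x t 0 <= gamma] | P in A].

End Ambiguity.

(* Main.v *)
(* Given P in the relaxed ambiguity set, average it over all permutations of the
   coordinates: the product event keeps its probability, and P now has a single
   second moment d and a single cross moment c.  The Loewner bound becomes
   d - c <= d0 - c0 and d + (T-1) c <= d0 + (T-1) c0, with d0, c0 the targets.
   Mixing with weight e a law on the diagonal ray, with the same mean and a large
   second moment, turns the second bound into an equality; then c >= c0 > 0.
   Finally mix with the law that moves the whole sum to one uniformly chosen
   coordinate: it has the same mean and the same law of the sum, cross moments 0
   and product 0, so the weight that brings c down to c0 also gives d0, and the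
   product event does not lose probability.  The total loss is at most e. *)
Require Import Defs.
From HB Require Import structures.
From mathcomp Require Import all_boot all_order all_algebra.
From mathcomp Require Import all_fingroup.
From mathcomp Require Import all_classical all_reals all_analysis.
From mathcomp Require Import measurable_realfun ring lra.
Import Order.TTheory GRing.Theory Num.Theory.
Import numFieldNormedType.Exports.
Local Open Scope classical_set_scope.
Local Open Scope ring_scope.
Set Implicit Arguments.
Unset Strict Implicit.
Unset Printing Implicit Defensive.

(** * Means of functions under mixtures and images of laws *)

Section HasMean.
Local Open Scope ereal_scope.
Context d (W : measurableType d) (R : realType).
Implicit Types (P Q : probability W R) (g h : W -> R).

(** Integrability is bundled with a real value, so a mean never comes from a default value of
    [fine], and means of mixtures reduce to real arithmetic. *)
Definition has_mean P g (m : R) : Prop :=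
  P.-integrable setT (EFin \o g) /\ \int[P]_x (g x)%:E = m%:E.

Lemma has_mean_sum P (I : finType) (g : I -> W -> R) (m : I -> R) :
  (forall i, has_mean P (g i) (m i)) ->
  has_mean P (fun x => \sum_i g i x)%R (\sum_i m i)%R.
Proof.
move=> H; split.
  rewrite (_ : _ \o _ = (fun x => \sum_(i <- index_enum I) (EFin \o g i) x)).
    by apply: integrable_sum => // i _; have [] := H i.
  by apply/funext => x /=; rewrite sumEFin.
under eq_integral do rewrite -sumEFin.
rewrite integral_sum//=; last by move=> i; have [] := H i.
by rewrite -sumEFin; apply: eq_bigr => i _; have [_ ->] := H i.
Qed.

Lemma has_mean_if P (b : bool) g (m : R) : has_mean P g m ->
  has_mean P (fun x => if b then g x else 0)%R (if b then m else 0)%R.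
Proof.
case: b => // _; split; last by rewrite integral0.
by rewrite (_ : _ \o _ = cst 0); [exact: integrable0|].
Qed.

Lemma has_mean_dirac (a : W) g : measurable_fun setT g ->
  has_mean [the probability W R of \d_a] g (g a).
Proof.
move=> mg.
have mE : measurable_fun setT (EFin \o g) by exact/measurable_EFinP.
split.
  apply/integrableP; split => //.
  by rewrite integral_dirac ?diracT ?mul1e ?ltry//; exact: measurableT_comp.
by rewrite integral_dirac// diracT mul1e.
Qed.

Section Mixture.
Variables (P Q : probability W R) (t : R).
Hypotheses (t0 : (0 <= t)%R) (t1 : (0 <= 1 - t)%R).

Definition mixture : set W -> \bar R :=
  measure_add (mscale (NngNum t0) P) (mscale (NngNum t1) Q).

HB.instance Definition _ := Measure.on mixture.

Lemma mixtureE A : mixture A = t%:E * P A + (1 - t)%:E * Q A.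
Proof. by rewrite /mixture measure_addE. Qed.

Let mixture_setT : mixture setT = 1.
Proof.
by rewrite mixtureE !probability_setT !mule1 -EFinD addrC subrK.
Qed.

HB.instance Definition _ :=
  @Measure_isProbability.Build _ _ R mixture mixture_setT.

Lemma ge0_integral_mixture (f : W -> \bar R) :
  measurable_fun setT f -> (forall x, 0 <= f x) ->
  \int[mixture]_x f x = t%:E * \int[P]_x f x + (1 - t)%:E * \int[Q]_x f x.
Proof.
by move=> mf f0; rewrite ge0_integral_measure_add// !ge0_integral_mscale.
Qed.

Lemma has_mean_mixture g m m' : has_mean P g m -> has_mean Q g m' ->
  has_mean [the probability W R of mixture] g (t * m + (1 - t) * m')%R.
Proof.
move=> [iP mP] [iQ mQ].
have mg : measurable_fun setT (EFin \o g) by case/integrableP: iP.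
split.
  apply/integrableP; split => //.
  rewrite ge0_integral_mixture//; last exact: measurableT_comp.
  case/integrableP: iP => _ iP; case/integrableP: iQ => _ iQ.
  apply: lte_add_pinfty; apply: lte_mul_pinfty; rewrite ?lee_fin//.
(* The mixture formula is at hand for nonnegative integrands only, so [g] is split into positive and
   negative parts; integrability makes all four integrals finite. *)
rewrite integralE !ge0_integral_mixture//; last 2 first.
- exact: measurable_funeneg.
- exact: measurable_funepos.
have fP := integrable_pos_fin_num measurableT iP.
have fQ := integrable_pos_fin_num measurableT iQ.
have nP := integrable_neg_fin_num measurableT iP.
have nQ := integrable_neg_fin_num measurableT iQ.
move: mP mQ; rewrite integralE [X in _ -> X = _ -> _]integralE.
rewrite -(fineK fP) -(fineK fQ) -(fineK nP) -(fineK nQ).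
rewrite -!(EFinM, EFinB, EFinD) => -[<-] [<-]; congr EFin; ring.
Qed.

End Mixture.

Lemma mixtureP P Q (t : R) : (0 <= t <= 1)%R -> exists M : probability W R,
  (forall A, M A = t%:E * P A + (1 - t)%:E * Q A) /\
  (forall g m m', has_mean P g m -> has_mean Q g m' ->
    has_mean M g (t * m + (1 - t) * m')%R).
Proof.
case/andP => t0; rewrite -subr_ge0 => t1.
exists (mixture P Q t0 t1); split; first exact: mixtureE.
by move=> g m m'; exact: has_mean_mixture.
Qed.

(** Induction on [n]: the new law enters with weight [1/(n+2)] and the uniform mixture of the
    earlier ones keeps the rest. *)
Lemma uniform_mixture (n : nat) (F : nat -> probability W R) :
  exists M : probability W R,
  (forall A, M A = n.+1%:R^-1%:E * \sum_(i < n.+1) F i A) /\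
  (forall g m, (forall i, (i <= n)%N -> has_mean (F i) g (m i)) ->
    has_mean M g (n.+1%:R^-1 * \sum_(i < n.+1) m i)%R).
Proof.
elim: n => [|n [M [ME Mm]]].
  exists (F 0%N); split=> [A|g m H]; first by rewrite big_ord1 invr1 mul1e.
  by rewrite big_ord1 invr1 mul1r; exact: H.
have t01 : (0 <= (n.+2%:R^-1 : R) <= 1)%R.
  by rewrite invr_ge0 ler0n/= invf_le1 ?ler1n// ltr0n.
have tE : (1 - n.+2%:R^-1 = n.+2%:R^-1 * n.+1%:R :> R)%R.
  have n2 : (n.+2%:R != 0 :> R)%R by rewrite pnatr_eq0.
  by apply: (mulfI n2); rewrite mulrBr mulr1 mulrA divff// mul1r -[n.+2]addn1 natrD addrK.
have [N [NE Nm]] := mixtureP (F n.+1) M t01.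
exists N; split=> [A|g m H].
  rewrite NE ME tE [in RHS]big_ord_recr/= ge0_muleDr; last 2 first.
  - by apply: sume_ge0 => i _.
  - exact: measure_ge0.
  by rewrite addeC muleA -EFinM mulfK ?pnatr_eq0.
rewrite (_ : _ * _ = n.+2%:R^-1 * m n.+1 +
    (1 - n.+2%:R^-1) * (n.+1%:R^-1 * \sum_(i < n.+1) m i))%R; last first.
  by rewrite tE mulrA mulfK ?pnatr_eq0// big_ord_recr/= mulrDr addrC.
by apply: Nm; [exact: H|apply: Mm => i i_n; exact/H/ltnW].
Qed.

Lemma uniform_mixture_fin (I : finType) (i0 : I) (F : I -> probability W R) :
  exists M : probability W R,
  (forall A, M A = #|I|%:R^-1%:E * \sum_i F i A) /\
  (forall g m, (forall i, has_mean (F i) g (m i)) ->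
    has_mean M g (#|I|%:R^-1 * \sum_i m i)%R).
Proof.
have I0 : #|I| = #|I|.-1.+1 by rewrite prednK//; apply/card_gt0P; exists i0.
(* Stated for any [nmodType] because it serves both the extended real probabilities and the real
   means. *)
have E (A : nmodType) (f : I -> A) :
    (\sum_(k < #|I|) f (nth i0 (enum I) k) = \sum_i f i)%R.
  rewrite cardE -(big_mkord xpredT (fun k => f (nth i0 (enum I) k))).
  by rewrite -(big_nth i0 xpredT f) big_enum.
have [M [ME Mm]] := uniform_mixture #|I|.-1 (F \o nth i0 (enum I)).
rewrite -I0 in ME Mm.
exists M; split=> [A|g m H]; first by rewrite ME (E _ (F^~ A)).
by rewrite -(E _ m); apply: (Mm g (m \o nth i0 (enum I))) => k _; exact: H.
Qed.

End HasMean.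

Lemma pushforward_has_mean d d' (W : measurableType d) (W' : measurableType d')
    (R : realType) (P : probability W R) (f : W -> W') :
  measurable_fun setT f ->
  exists M : probability W' R, (forall A, M A = P (f @^-1` A)) /\
    (forall g m, measurable_fun setT g -> has_mean P (g \o f) m ->
      has_mean M g m).
Proof.
move=> mf.
pose F : {mfun W >-> W'} := HB.pack f (isMeasurableFun.Build _ _ _ _ _ mf).
exists (distribution P F); split=> [//|g m mg [ig mgm]].
have mE : measurable_fun setT (EFin \o g) by exact/measurable_EFinP.
by split; [exact: integrable_pushforward|rewrite integral_distribution].
Qed.

(** * Continuity and Borel measurability on R^T *)

Section Borel.
Variables (R : realType) (T : nat).
Local Notation V := (borel_cV R T).
Implicit Types (P Q : probability V R) (g h : V -> R) (x : 'cV[R]_T).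

Lemma coord_continuous (t : 'I_T) : continuous (fun x => x t 0).
Proof.
(* Neighbourhoods of a matrix are generated by boxes; this box constrains row [t] alone. *)
move=> x A xA; exists (fun i _ => if i == t then A else setT) => [i j|y /(_ t 0)].
  by case: eqP => [->|_]; [rewrite (ord1 j)|exact: filterT].
by rewrite eqxx.
Qed.

Lemma sum_coord_continuous : continuous (fun x => \sum_t x t 0).
Proof.
elim: (index_enum _) => [|t s IHs] x.
  rewrite (_ : (fun y => _) = cst 0); first exact: cst_continuous.
  by apply/funext => y; rewrite big_nil.
rewrite (_ : (fun _ => _) =
    (fun y : 'cV[R]_T => y t 0) \+ (fun y => \sum_(i <- s) y i 0)).
  by apply: continuousD; [exact: coord_continuous|exact: IHs].
by apply/funext => y; rewrite big_cons.
Qed.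

(** A neighbourhood of [f x] contains a box, and finitely many coordinate conditions hold together
    near [x], so [f] is continuous; preimages of the generating open sets are then open. *)
Lemma borel_measurable_fun (f : 'cV[R]_T -> 'cV[R]_T) :
  (forall t, continuous (fun x => f x t 0)) ->
  measurable_fun setT (f : V -> V).
Proof.
move=> cf; have fcont : continuous f.
  move=> x A [B xB sBA]; rewrite nbhs_filterE.
  suff : \forall y \near x, forall t, B t 0 (f y t 0).
    by apply: filterS => y yB; apply: sBA => i j; rewrite (ord1 j).
  apply: (@filter_forall _ _ (fun t y => B t 0 (f y t 0)) (nbhs x)) => t.
  exact: (cf t x _ (xB t 0)).
apply: (@measurability _ _ V V setT f (@open 'cV[R]_T) erefl) => _ [A oA <-].
rewrite setTI; apply: sub_sigma_algebra.
by move/continuousP: fcont; exact.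
Qed.

Lemma coord_measurable (t : 'I_T) : measurable_fun setT (fun x : V => x t 0).
Proof.
apply: (@measurability _ _ V _ setT _ _ (RGenOpens.measurableE R)) => _ [_ [a [b ->] <-]].
rewrite setTI; apply: sub_sigma_algebra.
have /continuousP := @coord_continuous t.
by apply; exact: interval_open.
Qed.

Lemma prod_le_measurable (gamma : R) :
  measurable [set x : V | \prod_(t < T) rvec x t 0 <= gamma].
Proof.
have mp : measurable_fun setT (fun x : V => \prod_(t < T) x t 0).
  by apply: measurable_prod => t _; exact: coord_measurable.
have := mp measurableT _ (measurable_itv `]-oo, gamma]).
rewrite setTI; congr measurable.
Qed.

Lemma nonneg_measurable :
  measurable [set x : V | forall t, 0 <= rvec x t 0].
Proof.
rewrite (_ : [set _ | _] = \bigcap_(t in [set: 'I_T]) [set x : V | 0 <= x t 0]).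
  apply: fin_bigcap_measurable => // t _.
  have := coord_measurable t measurableT (measurable_itv `[0%R, +oo[).
  rewrite setTI; congr measurable.
  by apply/seteqP; split=> x /=; rewrite in_itv andbT.
by apply/seteqP; split=> x H t; [move=> _; exact: H|exact: (H t I)].
Qed.

End Borel.

(** * Laws with permutation-invariant moments *)

Lemma sum_if_eq (R : nzRingType) T (d c : R) :
  \sum_(i < T) \sum_(j < T) (if i == j then d else c) =
  T%:R * (d + (T%:R - 1) * c).
Proof.
rewrite (eq_bigr (fun=> d + (T%:R - 1) * c)) => [|i _].
  by rewrite sumr_const card_ord mulr_natl.
rewrite (bigD1 i)//= eqxx; congr (_ + _).
rewrite (eq_bigr (fun=> c)); last by move=> j; rewrite eq_sym => /negbTE ->.
rewrite sumr_const cardC1 card_ord -[c *+ _]mulr_natl; congr (_ * _).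
by rewrite -[in RHS](prednK (leq_ltn_trans (leq0n i) (ltn_ord i)))
  -[X in X - _]natr1 addrK.
Qed.

(* [a] mean, [d] second moment, [c] cross moment. *)
Definition exchangeable_moments (R : realType) (T : nat)
    (P : probability (borel_cV R T) R) (a d c : R) : Prop :=
  [/\ nonneg_supported P,
      forall t, has_mean P (fun x : borel_cV R T => x t 0) a &
      forall s t, has_mean P (fun x : borel_cV R T => x s 0 * x t 0)
                    (if s == t then d else c)].

Section Exchangeable.
Variables (R : realType) (T : nat).
Local Notation V := (borel_cV R T).
Local Notation prodle gamma := [set x : V | \prod_(t < T) rvec x t 0 <= gamma].
Local Notation nonneg := [set x : V | forall t, 0 <= rvec x t 0].
Implicit Types P Q : probability V R.

Lemma prod_coord_measurable (s t : 'I_T) :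
  measurable_fun setT (fun x : V => x s 0 * x t 0).
Proof. by apply: measurable_funM; exact: coord_measurable. Qed.

Lemma nonneg_preimage P (f : V -> V) : measurable_fun setT f ->
  nonneg_supported P -> nonneg `<=` f @^-1` nonneg ->
  P (f @^-1` nonneg) = 1%E.
Proof.
move=> mf nP sub; apply/eqP; rewrite eq_le.
have mN : measurable (f @^-1` nonneg).
  by rewrite -[X in measurable X]setTI; apply: mf => //; exact: nonneg_measurable.
rewrite probability_le1//= -[leLHS]nP; apply: le_measure => //; rewrite inE//.
exact: nonneg_measurable.
Qed.

Lemma exchangeable_mixture P Q (p a d c a' d' c' : R) : 0 <= p <= 1 ->
  exchangeable_moments P a d c -> exchangeable_moments Q a' d' c' ->
  exists M : probability V R, (forall A, M A = (p%:E * P A + (1 - p)%:E * Q A)%E) /\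
    exchangeable_moments M (p * a + (1 - p) * a') (p * d + (1 - p) * d')
      (p * c + (1 - p) * c').
Proof.
move=> p01 [nP aP mP] [nQ aQ mQ].
have [M [ME Mm]] := mixtureP P Q p01.
exists M; split=> //; split.
- by rewrite /nonneg_supported ME nP nQ !mule1 -EFinD addrC subrK.
- by move=> t; exact: Mm.
- by move=> s t; have := Mm _ _ _ (mP s t) (mQ s t); case: ifP.
Qed.

Lemma exchangeable_dirac (r : R) : 0 <= r ->
  exists P : probability V R, exchangeable_moments P r (r ^+ 2) (r ^+ 2).
Proof.
move=> r0; pose x0 : V := (const_mx r : 'cV[R]_T).
exists [the probability V R of \d_x0]; split.
- rewrite /nonneg_supported /= diracE mem_set//= => t.
  by rewrite /rvec /x0 mxE.
- move=> t; have := has_mean_dirac x0 (@coord_measurable R T t).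
  by rewrite /x0 mxE.
- move=> s t; have := has_mean_dirac x0 (prod_coord_measurable s t).
  by rewrite /x0 !mxE if_same.
Qed.

(* Two atoms on the diagonal ray, at 0 and (q / a) 1. *)
Lemma exchangeable_ray (a q : R) : 0 < a -> a ^+ 2 <= q ->
  exists P : probability V R, exchangeable_moments P a q q.
Proof.
move=> a0 aq; have a2 : 0 < a ^+ 2 by rewrite exprn_gt0.
have q0 : 0 < q := lt_le_trans a2 aq.
have [P HP] := exchangeable_dirac (ltW (divr_gt0 q0 a0)).
have [Q HQ] := exchangeable_dirac (lexx 0).
(* The weight of the atom [q / a] is forced by the mean [a]; it is at most 1 exactly when [q] is at
   least the squared mean. *)
have p01 : 0 <= a ^+ 2 / q <= 1.
  by apply/andP; split; [exact/ltW/divr_gt0|rewrite ler_pdivrMr// mul1r].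
have [M [_]] := exchangeable_mixture p01 HP HQ.
have -> : a ^+ 2 / q * (q / a) + (1 - a ^+ 2 / q) * 0 = a.
  by field; rewrite !gt_eqF.
have -> : a ^+ 2 / q * (q / a) ^+ 2 + (1 - a ^+ 2 / q) * 0 ^+ 2 = q.
  by field; rewrite !gt_eqF.
by exists M.
Qed.

(* Replacing [x] by [(x_1 + ... + x_T) e_i], with [i] uniform, keeps the mean
   and the law of the sum, but kills all cross moments. *)
Lemma exchangeable_vertex P (a d c gamma : R) : (1 < T)%N -> 0 < gamma ->
  exchangeable_moments P a d c ->
  exists M : probability V R, M (prodle gamma) = 1%E /\
    exchangeable_moments M a (d + (T%:R - 1) * c) 0.
Proof.
move=> T1 gamma0 [nP aP mP]; have T0 : T%:R != 0 :> R by rewrite pnatr_eq0; case: T T1.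
pose f (i : 'I_T) (x : V) : V := \col_t (if t == i then \sum_s x s 0 else 0).
have fE i x t : f i x t 0 = if t == i then \sum_s x s 0 else 0 by rewrite mxE.
have mf i : measurable_fun setT (f i).
  apply: borel_measurable_fun => t.
  have [ti|ti] := eqVneq t i.
    rewrite (_ : (fun x => _) = (fun x : 'cV[R]_T => \sum_s x s 0)).
      exact: sum_coord_continuous.
    by apply/funext => x; rewrite fE ti eqxx.
  rewrite (_ : (fun x => _) = cst 0); first exact: cst_continuous.
  by apply/funext => x; rewrite fE (negbTE ti).
have [F HF] := choice (fun i => pushforward_has_mean P (mf i)).
have [M [ME Mm]] := uniform_mixture_fin (Ordinal T1) F.
rewrite card_ord in ME Mm.
have sumC (r : R) : T%:R^-1 * (\sum_(i < T) r) = r.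
  by rewrite sumr_const card_ord -[r *+ T]mulr_natl mulKf.
have M1 A : (forall i, F i A = 1%E) -> M A = 1%E.
  move=> FA; rewrite ME (eq_bigr (fun=> 1%:E))//.
  by rewrite sumEFin -EFinM sumC.
exists M; split.
  apply: M1 => i; have [-> _] := HF i; rewrite -(probability_setT P); congr (P _).
  apply/seteqP; split=> x //= _.
  (* Since [T] is at least 2, some coordinate other than [i] exists; it is 0, so the product is 0,
     below [gamma]. *)
  have [j ji] : exists j : 'I_T, j != i.
    have [i0|i0] := eqVneq i (Ordinal T1).
      by exists (Ordinal (ltnW T1)); rewrite i0.
    by exists (Ordinal T1); rewrite eq_sym.
  by rewrite (bigD1 j)//= fE (negbTE ji) mul0r ltW.
split.
- apply: M1 => i; have [-> _] := HF i; apply: nonneg_preimage => // x x0 t.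
  by rewrite /= /rvec fE; case: ifP => // _; apply: sumr_ge0 => s _; exact: x0.
- move=> t.
  have := Mm (fun x => x t 0) (fun i => if t == i then \sum_(s < T) a else 0).
  have -> : T%:R^-1 * (\sum_(i < T) (if t == i then \sum_(s < T) a else 0)) = a.
    by rewrite -big_mkcond/= (big_pred1 t) ?sumC// => i; rewrite eq_sym.
  apply => i; have [_] := HF i.
  apply; first exact: coord_measurable.
  rewrite (_ : _ \o _ = fun x : V => if t == i then \sum_s x s 0 else 0).
    by apply: has_mean_if; exact: has_mean_sum.
  by apply/funext => x /=; rewrite fE.
(* [K] is the second moment of the sum of the coordinates. Coordinates [s] and [t] of [f i x] can
   both be nonzero only when [s = t = i], so averaging over [i] leaves [K / T] on the diagonal and 0
   elsewhere. *)
- move=> s t; pose K := \sum_(s < T) \sum_(t < T) (if s == t then d else c).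
  have KE : K = T%:R * (d + (T%:R - 1) * c) by exact: sum_if_eq.
  have := Mm (fun x => x s 0 * x t 0)
    (fun i => if (s == i) && (t == i) then K else 0).
  have -> : T%:R^-1 * (\sum_(i < T) (if (s == i) && (t == i) then K else 0))
          = if s == t then d + (T%:R - 1) * c else 0.
    rewrite -big_mkcond/=; case: eqVneq => [<-|st].
      rewrite (big_pred1 s) ?KE ?mulKf// => i.
      by rewrite andbb eq_sym.
    rewrite big_pred0 ?mulr0// => i.
    by apply/negP => /andP[/eqP si /eqP ti]; rewrite si ti eqxx in st.
  apply => i; have [_] := HF i; apply; first exact: prod_coord_measurable.
  rewrite (_ : _ \o _ = fun x : V =>
    if (s == i) && (t == i) then \sum_s \sum_t x s 0 * x t 0 else 0).
    by apply: has_mean_if; apply: has_mean_sum => s'; exact: has_mean_sum.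
  apply/funext => x /=; rewrite !fE.
  case: (s == i); case: (t == i) => /=; rewrite ?(mul0r, mulr0)//.
  by rewrite big_distrl/=; apply: eq_bigr => j _; rewrite big_distrr.
Qed.

End Exchangeable.

(** * Averaging over permutations of the coordinates *)

Lemma sum_perm_pair (A : nmodType) n (S : 'I_n -> 'I_n -> A) (i j i' j' : 'I_n) :
  i != j -> i' != j' ->
  \sum_(s : 'S_n) S (s i) (s j) = \sum_(s : 'S_n) S (s i') (s j').
Proof.
move=> ij ij'; have [p [pi pj]] : exists p : 'S_n, p i' = i /\ p j' = j.
  (* First [u] sends [i'] to [i]; the second transposition sends [u j'] to [j] and fixes [i], which
     differs from both. This is transitivity on ordered pairs of distinct indices. *)
  pose u := tperm i' i; have ui : u i' = i by exact: tpermL.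
  exists (u * tperm (u j') j)%g; split; last by rewrite permM tpermL.
  by rewrite permM ui tpermD// 1?eq_sym// -ui (inj_eq perm_inj).
rewrite [RHS](reindex_inj (mulgI p))/=.
by apply: eq_bigr => s _; rewrite !permM pi pj.
Qed.

Lemma sum_perm_diag (A : nmodType) n (S : 'I_n -> 'I_n -> A) (i i' : 'I_n) :
  \sum_(s : 'S_n) S (s i) (s i) = \sum_(s : 'S_n) S (s i') (s i').
Proof.
rewrite [RHS](reindex_inj (mulgI (tperm i' i)))/=.
by apply: eq_bigr => s _; rewrite !permM tpermL.
Qed.

Lemma quad_form_sum (R : realType) n (A : 'M[R]_n) (v : 'cV[R]_n) :
  (v^T *m A *m v) 0 0 = \sum_i \sum_j v i 0 * v j 0 * A i j.
Proof.
rewrite -mulmxA mxE; apply: eq_bigr => i _; rewrite !mxE big_distrr/=.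
by apply: eq_bigr => j _; rewrite [A i j * _]mulrC mulrA.
Qed.

(** Tests the quadratic form at the all-ones vector. A matrix with diagonal [d] and other entries
    [c] has eigenvalue [d + (T - 1) c] there and [d - c] on the orthogonal complement, so this test
    and the next one capture its positivity. *)
Lemma psdmx_sum_ge0 (R : realType) n (A : 'M[R]_n) : psdmx A ->
  0 <= \sum_i \sum_j A i j.
Proof.
move=> [_ /(_ (const_mx 1))]; rewrite quad_form_sum; congr (_ <= _).
by apply: eq_bigr => i _; apply: eq_bigr => j _; rewrite !mxE !mul1r.
Qed.

(** Tests the quadratic form at [e_i - e_j]. *)
Lemma psdmx_diff_ge0 (R : realType) n (A : 'M[R]_n) (i j : 'I_n) :
  psdmx A -> i != j -> 0 <= A i i - A i j - A j i + A j j.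
Proof.
move=> [_ /(_ (\col_k ((k == i)%:R - (k == j)%:R)))] + ij.
rewrite quad_form_sum; congr (_ <= _).
have E (f : 'I_n -> R) :
    \sum_k ((k == i)%:R - (k == j)%:R) * f k = f i - f j.
  have ji : j != i by rewrite eq_sym.
  rewrite (bigD1 i)//= (bigD1 j)//= !eqxx (negbTE ij) (negbTE ji).
  rewrite big1 => [|k /andP[/negbTE-> /negbTE->]]; last first.
    by rewrite subrr mul0r.
  by rewrite /= subr0 sub0r mul1r mulN1r addr0.
transitivity (\sum_k ((k == i)%:R - (k == j)%:R) * (A k i - A k j)).
  apply: eq_bigr => k _; rewrite -E big_distrr/=.
  by apply: eq_bigr => l _; rewrite !mxE mulrA.
by rewrite E; ring.
Qed.

Section Symmetrization.
Variables (R : realType) (T : nat).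
Local Notation V := (borel_cV R T).
Local Notation prodle gamma := [set x : V | \prod_(t < T) rvec x t 0 <= gamma].
Implicit Types P Q : probability V R.

(** [M] is the uniform mixture of the laws of the permuted vectors. Each gives the product event its
    old probability, because a product does not depend on the order of its factors. *)
Lemma symmetrization P (a gamma : R) (S : 'I_T -> 'I_T -> R) (d c : R) :
  nonneg_supported P ->
  (forall t, has_mean P (fun x : V => x t 0) a) ->
  (forall s t, has_mean P (fun x : V => x s 0 * x t 0) (S s t)) ->
  (forall i j, #|'S_T|%:R^-1 * \sum_(s : 'S_T) S (s i) (s j) =
    if i == j then d else c) ->
  exists M : probability V R, M (prodle gamma) = P (prodle gamma) /\
    exchangeable_moments M a d c.
Proof.
move=> nP aP mP SE.
pose f (s : 'S_T) (x : V) : V := \col_t x (s t) 0.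
have fE s x t : f s x t 0 = x (s t) 0 by rewrite mxE.
have mf s : measurable_fun setT (f s).
  apply: borel_measurable_fun => t.
  rewrite (_ : (fun x => _) = (fun x : 'cV[R]_T => x (s t) 0)).
    exact: coord_continuous.
  by apply/funext => x; rewrite fE.
have [F HF] := choice (fun s => pushforward_has_mean P (mf s)).
have [M [ME Mm]] := uniform_mixture_fin (1%g : 'S_T) F.
have S0 : #|'S_T|%:R != 0 :> R.
  by rewrite pnatr_eq0 -lt0n; apply/card_gt0P; exists 1%g.
(* The common probability is taken as a real [r] so that the average is computed in [R]. *)
have M1 A (r : R) : (forall s, F s A = r%:E) -> M A = r%:E.
  move=> FA; rewrite ME (eq_bigr (fun=> r%:E))//.
  by rewrite sumEFin -EFinM sumr_const -[r *+ _]mulr_natl mulKf.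
exists M; split.
  have := fin_num_measure P _ (prod_le_measurable gamma).
  move/fineK <-; apply: M1 => s; have [-> _] := HF s.
  rewrite fineK ?fin_num_measure//; last exact: prod_le_measurable.
  congr (P _); apply/funext => x; rewrite /preimage /mkset /rvec.
  rewrite [in RHS](reindex_inj (@perm_inj _ s))/=.
  by under eq_bigr do rewrite fE.
split.
- apply: M1 => s; have [-> _] := HF s; apply: nonneg_preimage => // x x0 t.
  by rewrite /= /rvec fE; exact: x0.
- move=> t; have := Mm (fun x => x t 0) (fun=> a).
  rewrite sumr_const -[a *+ _]mulr_natl mulKf//; apply => s.
  have [_] := HF s; apply; first exact: coord_measurable.
  rewrite (_ : _ \o _ = fun x : V => x (s t) 0)//.
  by apply/funext => x /=; rewrite fE.
- move=> i j; rewrite -SE.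
  apply: (Mm (fun x => x i 0 * x j 0) (fun s => S (s i) (s j))) => s.
  have [_] := HF s; apply; first exact: prod_coord_measurable.
  rewrite (_ : _ \o _ = fun x : V => x (s i) 0 * x (s j) 0)//.
  by apply/funext => x /=; rewrite !fE.
Qed.

End Symmetrization.

(** Averaging is monotone, so the two quadratic tests of the Loewner bound pass to the averaged
    matrix. *)
Lemma perm_average_psd (R : realType) T (S : 'M[R]_T) (d0 c0 : R) : (1 < T)%N ->
  psdmx (\matrix_(i, j) (if i == j then d0 else c0) - S) ->
  exists d c, [/\ forall i j, #|'S_T|%:R^-1 * \sum_(s : 'S_T) S (s i) (s j) =
      if i == j then d else c,
    d - c <= d0 - c0 & d + (T%:R - 1) * c <= d0 + (T%:R - 1) * c0].
Proof.
move=> T1 psd; have T0 : 0 < T%:R :> R by rewrite ltr0n ltnW.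
pose avg f : R := #|'S_T|%:R^-1 * \sum_(s : 'S_T) f s.
have S0 : 0 < #|'S_T|%:R :> R.
  by rewrite ltr0n; apply/card_gt0P; exists 1%g.
have avgC r : avg (fun=> r) = r.
  by rewrite /avg sumr_const -[r *+ _]mulr_natl mulKf// gt_eqF.
have avg_le f g : (forall s, f s <= g s) -> avg f <= avg g.
  by move=> fg; rewrite ler_pM2l ?invr_gt0//; exact: ler_sum.
pose i0 := Ordinal (ltnW T1); pose i1 := Ordinal T1.
pose d := avg (fun s => S (s i0) (s i0)); pose c := avg (fun s => S (s i0) (s i1)).
have E i j : avg (fun s => S (s i) (s j)) = if i == j then d else c.
  case: eqVneq => [<-|ij]; congr (_ * _); first exact: (sum_perm_diag S).
  exact: (sum_perm_pair S).
exists d, c; split=> //.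
(* The test at [e_(s i0) - e_(s i1)], averaged over [s], gives twice the wanted bound. *)
- have : avg (fun s : 'S_T => S (s i0) (s i0) - S (s i0) (s i1)
               - S (s i1) (s i0) + S (s i1) (s i1))
         <= avg (fun=> 2 * (d0 - c0)).
    apply: avg_le => s; have s01 : s i0 != s i1 by rewrite (inj_eq perm_inj).
    have := psdmx_diff_ge0 psd s01.
    by rewrite !mxE !eqxx (negbTE s01) eq_sym (negbTE s01); lra.
  rewrite avgC /avg !(big_split, sumrN)/= !mulrDr !mulrN.
  rewrite -!/(avg _) !E/=; lra.
- have := psdmx_sum_ge0 psd.
  rewrite (eq_bigr (fun i => \sum_j (if i == j then d0 else c0) -
                            \sum_j S i j)); last first.
    by move=> i _; rewrite -sumrB; apply: eq_bigr => j _; rewrite !mxE.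
  rewrite sumrB sum_if_eq subr_ge0.
  suff -> : \sum_i \sum_j S i j = T%:R * (d + (T%:R - 1) * c) by rewrite ler_pM2l.
  (* The total of the entries is unchanged by permuting rows and columns together, so it equals its
     own average. *)
  rewrite -sum_if_eq -[LHS]avgC.
  transitivity (\sum_i avg (fun s : 'S_T => \sum_j S (s i) (s j))).
    rewrite /avg -mulr_sumr [in RHS]exchange_big/=; congr (_ * _).
    apply: eq_bigr => s _; rewrite (reindex_inj (@perm_inj _ s))/=.
    by apply: eq_bigr => i _; rewrite (reindex_inj (@perm_inj _ s)).
  apply: eq_bigr => i _; rewrite /avg exchange_big/= mulr_sumr.
  by apply: eq_bigr => j _; exact: E.
Qed.

(** * Reaching the target moments *)

Lemma has_meanE d (W : measurableType d) (R : realType) (P : probability W R)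
    (g : W -> R) (m : R) :
  has_mean P g m <->
  P.-integrable setT (fun w => (g w)%:E) /\ fine 'E_P[g]%E = m.
Proof.
split=> -[ig mg]; split=> //; first by rewrite unlock mg.
by rewrite -mg unlock fineK//; exact: integrable_fin_num.
Qed.

Section Completion.
Variables (R : realType) (T : nat).
Local Notation V := (borel_cV R T).
Local Notation prodle gamma := [set x : V | \prod_(t < T) rvec x t 0 <= gamma].
Implicit Types P Q : probability V R.

Lemma mean_vecP P (mu : R) :
  mx_integrable P (@rvec R T) /\ mx_expectation P (@rvec R T) = mean_vec T mu <->
  forall t, has_mean P (fun x : V => x t 0) mu.
Proof.
split=> [[iP /matrixP eP] t|H].
  by apply/has_meanE; split; [exact: iP|have := eP t 0; rewrite !mxE].
split=> [t j|]; first by rewrite (ord1 j); have /has_meanE[] := H t.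
by apply/matrixP => t j; rewrite (ord1 j) !mxE; have /has_meanE[] := H t.
Qed.

Lemma outerP P (S : 'M[R]_T) :
  mx_integrable P (@outer R T) /\ mx_expectation P (@outer R T) = S <->
  forall s t, has_mean P (fun x : V => x s 0 * x t 0) (S s t).
Proof.
have oE s t : (fun x : V => outer x s t) = (fun x : V => x s 0 * x t 0).
  by apply/funext => x; rewrite !mxE big_ord1 mxE.
split=> [[iP /matrixP eP] s t|H].
  rewrite -oE; apply/has_meanE; split; first exact: iP.
  by have := eP s t; rewrite mxE.
have {}H s t : has_mean P (fun x : V => outer x s t) (S s t) by rewrite oE.
split=> [s t|]; first by have /has_meanE[] := H s t.
by apply/matrixP => s t; have /has_meanE[_ <-] := H s t; rewrite mxE.
Qed.

Lemma second_moment_mxE (mu sigma rho : R) :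
  cov_mx T sigma rho + mean_vec T mu *m (mean_vec T mu)^T =
  \matrix_(i, j) (if i == j then sigma ^+ 2 + mu ^+ 2
                  else mu ^+ 2 + rho * sigma ^+ 2).
Proof.
apply/matrixP => i j; rewrite !mxE !big_ord1 !mxE.
by case: (i == j) => /=; rewrite ?mulr1n ?mulr0n; ring.
Qed.

(** The bound on [T%:R * mu ^+ 2] says that the target second moment of the sum is at least its
    squared mean; it makes the ray law available. Positivity of [c0] makes the final weight
    [c0 / c1] meaningful. *)
Lemma exchangeable_completion P (mu d c d0 c0 e gamma : R) :
  (1 < T)%N -> 0 < mu -> 0 < c0 -> c0 <= d0 ->
  T%:R * mu ^+ 2 <= d0 + (T%:R - 1) * c0 -> 0 < e < 1 -> 0 < gamma ->
  exchangeable_moments P mu d c ->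
  d - c <= d0 - c0 -> d + (T%:R - 1) * c <= d0 + (T%:R - 1) * c0 ->
  exists M : probability V R, exchangeable_moments M mu d0 c0 /\
    (P (prodle gamma) <= M (prodle gamma) + e%:E)%E.
Proof.
move=> T1 mu0 c0gt0 cd0 Tmu /andP[e0 e1] gamma0 mP dc dTc.
have T0 : 0 < T%:R :> R by rewrite ltr0n ltnW.
(* [q] is the second moment on the ray that makes the second moment of the sum
   of the coordinates equal to its target [T s0]. *)
set s0 := d0 + (T%:R - 1) * c0 in Tmu dTc; set s := d + (T%:R - 1) * c in dTc.
have eT0 : 0 < e * T%:R by rewrite mulr_gt0.
pose q := (s0 - (1 - e) * s) / (e * T%:R).
have qE : e * T%:R * q = s0 - (1 - e) * s.
  by rewrite /q mulrC divfK// gt_eqF.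
(* As [s <= s0], [qE] gives [e T q >= e s0 >= e T mu^2]. *)
have muq : mu ^+ 2 <= q.
  rewrite -(ler_pM2l eT0) qE.
  have : (1 - e) * s <= (1 - e) * s0 by rewrite ler_pM2l// subr_gt0.
  have : e * (T%:R * mu ^+ 2) <= e * s0 by rewrite ler_pM2l.
  lra.
have [Q mQ] := exchangeable_ray T mu0 muq.
have e01 : 0 <= 1 - e <= 1 by apply/andP; split; lra.
have [M1 [M1E]] := exchangeable_mixture e01 mP mQ.
rewrite (_ : 1 - (1 - e) = e) in M1E *; last by ring.
rewrite (_ : (1 - e) * mu + e * mu = mu); last by ring.
set d1 := (1 - e) * d + e * q; set c1 := (1 - e) * c + e * q => mM1.
have s1E : d1 + (T%:R - 1) * c1 = s0.
  transitivity ((1 - e) * s + e * T%:R * q); last by rewrite qE; ring.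
  by rewrite /d1 /c1 /s; ring.
(* On the ray the second and cross moments agree, so mixing only scales [d - c] by [1 - e]. *)
have dc1 : d1 - c1 <= d0 - c0.
  rewrite (_ : d1 - c1 = (1 - e) * (d - c)); last by rewrite /d1 /c1; ring.
  have : (1 - e) * (d - c) <= (1 - e) * (d0 - c0) by rewrite ler_pM2l// subr_gt0.
  have : 0 <= e * (d0 - c0) by apply: mulr_ge0; [exact: ltW|rewrite subr_ge0].
  lra.
(* [T c] is the invariant [d + (T - 1) c] minus [d - c]: the first now agrees with the target, the
   second is no larger. *)
have c01 : c0 <= c1.
  rewrite -(ler_pM2l T0).
  have : T%:R * c0 = s0 - (d0 - c0) by rewrite /s0; ring.
  have : T%:R * c1 = s0 - (d1 - c1) by rewrite -s1E; ring.
  lra.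
have c1gt0 : 0 < c1 := lt_le_trans c0gt0 c01.
have [M2 [M2E mM2]] := exchangeable_vertex T1 gamma0 mM1.
have p01 : 0 <= c0 / c1 <= 1.
  by apply/andP; split; [exact/ltW/divr_gt0|rewrite ler_pdivrMr// mul1r].
have [M [ME mM]] := exchangeable_mixture p01 mM1 mM2.
exists M; split.
  have pc : c0 / c1 * c1 = c0 by rewrite divfK// gt_eqF.
  rewrite s1E in mM.
  rewrite (_ : c0 / c1 * mu + _ = mu) in mM; last by ring.
  rewrite (_ : c0 / c1 * c1 + _ = c0) in mM; last by rewrite pc mulr0 addr0.
  (* [M1] and [M2] share the value [s0] of [d + (T - 1) c], so a cross moment equal to [c0] forces
     the second moment [d0]. *)
  rewrite (_ : c0 / c1 * d1 + _ = d0) in mM => //.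
  transitivity (s0 - (T%:R - 1) * (c0 / c1 * c1)); last by rewrite pc /s0; ring.
  by rewrite -s1E; ring.
rewrite ME M2E M1E.
have fin (N : probability V R) :
    exists2 r, N (prodle gamma) = r%:E & 0 <= r <= 1.
  have mA := prod_le_measurable gamma.
  exists (fine (N (prodle gamma))); first by rewrite fineK// fin_num_measure.
  by rewrite -!lee_fin fineK ?fin_num_measure// measure_ge0 probability_le1.
have [u -> /andP[_ u1]] := fin P; have [v -> /andP[v0 v1]] := fin Q.
rewrite -!(EFinM, EFinD) lee_fin mulr1.
case/andP: p01; move: (c0 / c1) => p p0 p1.
have h1 : 0 <= e * v by rewrite mulr_ge0// ltW.
have h2 : e * u <= e by rewrite ler_piMr// ltW.
(* Replacing part of [M1] by [M2], whose product event is certain, cannot lower the probability;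
   only the factor [1 - e] on [u] costs, by at most [e]. *)
have h3 : 0 <= (1 - p) * (1 - ((1 - e) * u + e * v)).
  apply: mulr_ge0; first by rewrite subr_ge0.
  have : (1 - e) * u <= (1 - e) * 1 by rewrite ler_pM2l// subr_gt0.
  have : e * v <= e * 1 by rewrite ler_pM2l.
  lra.
lra.
Qed.

End Completion.

(** * Comparison of the two suprema *)

Theorem theorem5p1 (R : realType) (T : nat) (mu sigma rho : R)
    (hT : (2 <= T)%N) (hmu : 0 < mu) (hsigma : 0 < sigma)
    (hrho_lo : - (1 / (T%:R - 1)) < rho) (hrho_hi : rho < 1)
    (hpos : 0 < mu ^+ 2 + rho * sigma ^+ 2) :
  let L := worst_case_prob
             (ambiguity (mean_vec T mu) (cov_mx T sigma rho)) in
  let L' := worst_case_prob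
             (ambiguity_relaxed (mean_vec T mu) (cov_mx T sigma rho)) in
  forall gamma : R, 0 < gamma -> L' gamma = L gamma.
Proof.
move=> L L' gamma gamma0; apply/eqP; rewrite eq_le; apply/andP; split; last first.
  (* Equality of second moments gives the Loewner bound, as the zero matrix is positive
     semidefinite. *)
  apply: ereal_sup_le; apply: image_subset => P [nP mP [oP eP]]; split=> //; split=> //.
  rewrite /loewner_le eP subrr; split; first by rewrite trmx0.
  by move=> v; rewrite mulmx0 mul0mx mxE.
apply: ge_ereal_sup => _ [P [nP /mean_vecP mP [oP psd]] <-].
have /outerP SP := conj oP (erefl (mx_expectation P (@outer R T))).
move: psd; rewrite /loewner_le second_moment_mxE.
have s2 : 0 < sigma ^+ 2 by rewrite exprn_gt0.
have T10 : 0 < T%:R - 1 :> R by rewrite subr_gt0 ltr1n.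
move=> /(perm_average_psd hT)[d [c [SE dc dTc]]].
have [P' [<- mP']] := symmetrization gamma nP mP SP SE.
apply/lee_addgt0Pr => e e0.
(* The ray law needs a weight below 1, hence the cap at one half. *)
pose e' := Num.min e 2^-1.
have e'01 : 0 < e' < 1.
  by rewrite lt_min e0 invr_gt0 ltr0n/= gt_min invf_lt1 ?ltr1n ?ltr0n// orbT.
have c0d0 : mu ^+ 2 + rho * sigma ^+ 2 <= sigma ^+ 2 + mu ^+ 2.
  have : rho * sigma ^+ 2 <= 1 * sigma ^+ 2 by rewrite ler_pM2r// ltW.
  lra.
have Tmu : T%:R * mu ^+ 2 <=
    sigma ^+ 2 + mu ^+ 2 + (T%:R - 1) * (mu ^+ 2 + rho * sigma ^+ 2).
  (* The gap between the two sides is the eigenvalue of the covariance matrix at the all-ones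
     vector; the lower bound on [rho] makes it nonnegative. *)
  have : 0 <= (1 + (T%:R - 1) * rho) * sigma ^+ 2.
    apply: mulr_ge0; last exact: ltW.
    have := ltW hrho_lo; rewrite -(ler_pM2l T10) mulrN mul1r divff ?gt_eqF//.
    lra.
  lra.
have [M [[nM aM mM] leM]] :=
  exchangeable_completion hT hmu hpos c0d0 Tmu e'01 gamma0 mP' dc dTc.
apply: (le_trans leM); apply: leeD; last by rewrite lee_fin ge_min lexx.
apply: ereal_sup_ubound; exists M => //; split=> //; first exact/mean_vecP.
apply/outerP => s t; rewrite second_moment_mxE mxE; exact: mM.
Qed.
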